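(* Let $(\Sigma,\Lambda,z)$ be a compact discrete Riemann surface of genus $g$, and let $\tilde Q\in F(\tilde\Lambda)$ be a face of the lifted quad-decomposition of the universal covering. Then the restriction $\tilde{\mathcal A}_{\tilde Q}|_{V(\tilde\Lambda)}:V(\tilde\Lambda)\to\mathbb{C}^g$ of the discrete Abel-Jacobi map is discrete holomorphic in each component.
   Context: A surface means a connected oriented surface without boundary. A bipartite quad-decomposition $\Lambda$ of a surface $\Sigma$ is a cellular decomposition of $\Sigma$ that is locally finite (a compact subset of $\Sigma$ contains only finitely many faces) and strongly regular (two different faces are either disjoint or share only one vertex or share only one edge), all of whose 2-cells are quadrilaterals and whose 1-skeleton is bipartite. $V(\Lambda)$ and $F(\Lambda)$ are the sets of vertices and faces. A decomposition of $V(\Lambda)$ into two independent sets (black and white vertices) is fixed. $\Gamma$ ($\Gamma^*$) is the graph on the black (white) vertices whose edges are the black (white) diagonals of faces. For $Q\in F(\Lambda)$ with vertices $b_-,w_-,b_+,w_+$ in counterclockwise order ($b_\pm$ black, $w_\pm$ white), a chart $z_Q$ of $Q$ is an orientation-preserving embedding of $Q$ onto a rectilinear quadrilateral in $\mathbb{C}$ without self-intersections such that the images of $b_-,w_-,b_+,w_+$ are its vertices. Put $\rho_Q:=-i\,\frac{z_Q(w_+)-z_Q(w_-)}{z_Q(b_+)-z_Q(b_-)}$ (with positive real part); two charts are compatible if they give the same $\rho_Q$. A discrete Riemann surface $(\Sigma,\Lambda,z)$ is a bipartite quad-decomposition $\Lambda$ of a surface $\Sigma$ with an atlas $z$ of compatible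 charts $z_Q$, $Q\in F(\Lambda)$; it is compact if $\Sigma$ is. A function $f:V(\Lambda)\to\mathbb{C}$ is discrete holomorphic if $\frac{f(b_+)-f(b_-)}{z_Q(b_+)-z_Q(b_-)}=\frac{f(w_+)-f(w_-)}{z_Q(w_+)-z_Q(w_-)}$ for all faces $Q$. Medial graph $X$: its vertices are the midpoints of the edges of $\Lambda$; two of them are joined by an edge, denoted $[Q,v]$, if the corresponding edges of $\Lambda$ belong to the same face $Q$ and share the vertex $v$. $X$ is a cellular decomposition of $\Sigma$ with faces $F_v$ ($v\in V(\Lambda)$) and $F_Q$ ($Q\in F(\Lambda)$). If the oriented edge $e=[Q,v]$ goes from the midpoint of $vv'_-$ to the midpoint of $vv'_+$, put $z_Q(e):=(z_Q(v'_+)-z_Q(v'_-))/2$; $e$ is parallel to the (oriented) diagonal $v'_-v'_+$ of $Q$ and is called black (white) if $v'_\pm$ are black (white). A discrete one-form (discrete differential) $\omega$ is a complex function on the oriented edges of $X$ with $\omega(-e)=-\omega(e)$; write $\int_e\omega=\omega(e)$, extended additively to paths and chains. It is of type $\Diamond$ if for each face $Q$ and its two black (or two white) vertices $v,v'$ one has $\omega([Q,v])=-\omega([Q,v'])$, both edges oriented as in $\partial F_Q$. It is closed if $\oint_{\partial F}\omega=0$ for every face $F$ of $X$. On $\partial F_Q$, $dz_Q$ is given by $\int_e dz_Q=z_Q(e)$. A differential of type $\Diamond$ is discrete holomorphic if it is closed and for every $Q$ it is of the form $p\,dz_Q$ ($p\in\mathbb{C}$) on $\partial F_Q$. Let $\{a_1,\dots,a_g,b_1,\dots,b_g\}$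 be a canonical basis of $H_1(\Sigma,\mathbb{Z})$. For a closed path $P$ on $X$ in the class $a_j$, the black (white) $a_j$-period of a closed differential $\omega$ of type $\Diamond$ is twice the integral of $\omega$ over all black (white) oriented edges of $P$; it does not depend on $P$. The canonical set $\{\omega_1,\dots,\omega_g\}$ is the unique set of discrete holomorphic differentials such that both the black and the white $a_j$-period of $\omega_k$ equal $\delta_{jk}$ for all $1\le j,k\le g$. Let $\omega$ be the column vector with entries $\omega_1,\dots,\omega_g$. Let $p:\tilde\Sigma\to\Sigma$ be the universal covering, and let $\tilde\Lambda,\tilde X,\tilde\Gamma,\tilde\Gamma^*$ be the lifts of $\Lambda,X,\Gamma,\Gamma^*$; $(\tilde\Sigma,\tilde\Lambda,z\circ p)$ is a discrete Riemann surface, and $\omega$ is lifted to $\tilde X$. For an oriented path $R$ on $\tilde\Gamma$ or $\tilde\Gamma^*$, choose for each oriented edge of $R$ one of the parallel edges of $\tilde X$, oriented the same way, let $R_X$ be the resulting one-chain, and put $\int_R\omega:=2\int_{R_X}\omega$. Discrete Abel-Jacobi map on $V(\tilde\Lambda)$: for a black vertex $v$ of $\tilde\Lambda$, $\tilde{\mathcal A}_{\tilde Q}(v):=\int_d\omega+\int_R\omega$, where $R$ is an oriented path on $\tilde\Gamma$ from a black vertex $b$ of $\tilde Q$ to $v$ and $d$ is an edge of $\tilde X$ parallel to the black diagonal of $\tilde Q$, oriented toward $b$. For a white vertex $v'$, $\tilde{\mathcal A}_{\tilde Q}(v')$ is defined in the same way with $\tilde\Gamma^*$, a white vertex of $\tilde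 Q$ and the white diagonal of $\tilde Q$. These do not depend on the choices. *)

(* Defs.v *)
(* Discrete Riemann surfaces (MathComp, with the complex numbers R[i] over a
   realType R).  The quad-decomposition is given combinatorially: faces with
   four labelled corners and a gluing of their sides. *)
From HB Require Import structures.
From mathcomp Require Import all_boot all_order all_algebra.
From mathcomp Require Import complex.
From mathcomp Require Import boolp classical_sets reals.
From Stdlib Require Import Relations.

Set Implicit Arguments.
Unset Strict Implicit.
Unset Printing Implicit Defensive.

Import GRing.Theory Num.Theory.
Local Open Scope ring_scope.
Local Open Scope complex_scope.

(** * Corners of a face, in counterclockwise order b-, w-, b+, w+ *)

Inductive corner := Bm | Wm | Bp | Wp.

Definition corner_code (c : corner) : bool * bool :=
  match c with
  | Bm => (true, false) | Wm => (false, false)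
  | Bp => (true, true) | Wp => (false, true)
  end.

Definition corner_decode (x : bool * bool) : corner :=
  match x with
  | (true, false) => Bm | (false, false) => Wm
  | (true, true) => Bp | (false, true) => Wp
  end.

Lemma corner_codeK : cancel corner_code corner_decode.
Proof. by case. Qed.

HB.instance Definition _ := Finite.copy corner (can_type corner_codeK).

Definition next (c : corner) : corner :=
  match c with Bm => Wm | Wm => Bp | Bp => Wp | Wp => Bm end.

Definition prev (c : corner) : corner :=
  match c with Bm => Wp | Wm => Bm | Bp => Wm | Wp => Bp end.

Definition opp (c : corner) : corner :=
  match c with Bm => Bp | Wm => Wp | Bp => Bm | Wp => Wm end.

Definition is_black (c : corner) : bool :=
  match c with Bm | Bp => true | Wm | Wp => false end.

(** * Bipartite quad-decompositions *)

(* A pair x = (Q, c) stands for the corner c of the face Q, and also for the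
   side of Q that runs counterclockwise from the corner c to the corner next c.
   If sides are glued along [glue] with opposite orientations, the corner that
   follows (Q, c) counterclockwise around their common vertex lies in the face
   on the other side of (Q, prev c). *)
Definition rotation (F : eqType) (glue : F * corner -> F * corner)
  (x : F * corner) : F * corner := glue (x.1, prev x.2).

Definition strongly_regular (F V : eqType) (vtx : F * corner -> V)
    (glue : F * corner -> F * corner) : Prop :=
  forall Q Q' : F, Q <> Q' ->
    [\/ (* disjoint *)
        forall c c', vtx (Q, c) <> vtx (Q', c'),
        (* only one common vertex *)
        exists d d', forall c c',
          vtx (Q, c) = vtx (Q', c') <-> c = d /\ c' = d'
      | (* only one common edge, with its two endpoints *)
        exists d d', glue (Q, d) = (Q', d') /\
          forall c c', vtx (Q, c) = vtx (Q', c') <->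
            (c = d /\ c' = next d') \/ (c = next d /\ c' = d')].

(* F and V are the sets of faces and vertices; the decomposition is compact iff
   F is finite. *)
Record quad_decomposition (F V : eqType) := QuadDecomposition {
  vtx : F * corner -> V;
  glue : F * corner -> F * corner;
  black : V -> bool;
  black_vtx : forall x, black (vtx x) = is_black x.2;
  (* each side is glued to exactly one other side: no boundary *)
  glueK : involutive glue;
  (* the corners at a vertex form one finite cycle: every vertex is an interior
     point, and the decomposition is locally finite *)
  vtx_surj : forall v, exists x, vtx x = v;
  vtx_eq : forall x y, vtx x = vtx y <-> exists n, iter n (rotation glue) x = y;
  rotation_finite : forall x, exists n, iter n.+1 (rotation glue) x = x;
  connected_faces : forall Q Q', exists s,
    path [rel P P' | [exists c, (glue (P, c)).1 == P']] Q s /\ last Q s = Q';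
  (* closed faces are embedded *)
  face_inj : forall Q, injective (fun c => vtx (Q, c));
  vtx_strongly_regular : strongly_regular vtx glue }.

Definition edges (F V : finType) (L : quad_decomposition F V) :
  {set {set F * corner}} := [set [set x; glue L x] | x in [set: F * corner]].

Definition genus (F V : finType) (L : quad_decomposition F V) (g : nat) : Prop :=
  #|V|%:Z - #|edges L|%:Z + #|F|%:Z = 2 - 2 * g%:Z.

(** * Charts *)

Definition segment (R : realType) (p q : R[i]) : set R[i] :=
  [set x | exists t : R, 0 <= t <= 1 /\ x = (1 - t)%:C * p + t%:C * q]%classic.

(* Only the images of the four corners are recorded: they determine the image
   quadrilateral.  Orientation is expressed by the shoelace formula for twice
   the signed area. *)
Definition is_chart (R : realType) (zQ : corner -> R[i]) : Prop :=
  [/\ forall c, (segment (zQ c) (zQ (next c)) `&`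
        segment (zQ (next (next c))) (zQ (prev c)) = set0)%classic,
      forall c, (segment (zQ (prev c)) (zQ c) `&`
        segment (zQ c) (zQ (next c)) = [set zQ c])%classic
    & 0 < \sum_(c : corner) complex.Im ((zQ c)^* * zQ (next c))].

Definition atlas (R : realType) (F : eqType) (z : F -> corner -> R[i]) : Prop :=
  forall Q, is_chart (z Q).

Definition discrete_holomorphic (R : realType) (F V : eqType)
    (L : quad_decomposition F V) (z : F -> corner -> R[i]) (f : V -> R[i]) : Prop :=
  forall Q,
    (f (vtx L (Q, Bp)) - f (vtx L (Q, Bm))) / (z Q Bp - z Q Bm) =
    (f (vtx L (Q, Wp)) - f (vtx L (Q, Wm))) / (z Q Wp - z Q Wm).

(** * The medial graph X *)

(* ((Q, c), true) is the edge [Q, v], v = vtx (Q, c), oriented as in the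
   counterclockwise boundary of F_Q: from the midpoint of the side (Q, prev c)
   to the midpoint of the side (Q, c).  ((Q, c), false) is its reverse. *)
Definition medge (F : eqType) : Type := ((F * corner) * bool)%type.

(* an oriented diagonal of Q is given by Q and its head; its tail is the
   opposite corner *)
Definition diagonal (F : eqType) : Type := (F * corner)%type.

Section Medial.
Variable F : eqType.
Implicit Types (e : medge F) (x : F * corner).

Definition reverse e : medge F := (e.1, ~~ e.2).

Definition side_from e : F * corner :=
  if e.2 then (e.1.1, prev e.1.2) else e.1.

Definition side_to e : F * corner :=
  if e.2 then e.1 else (e.1.1, prev e.1.2).

(* the oriented diagonal v'_- v'_+ to which e is parallel *)
Definition parallel e : diagonal F :=
  (e.1.1, if e.2 then next e.1.2 else prev e.1.2).

Definition black_edge e : bool := is_black (parallel e).2.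

Definition dz (R : realType) (z : F -> corner -> R[i]) e : R[i] :=
  (z (parallel e).1 (parallel e).2 - z (parallel e).1 (opp (parallel e).2)) / 2.

Variables (V : eqType) (L : quad_decomposition F V).

(* the midpoints of the sides x and glue x are the same vertex of X *)
Definition consecutive : rel (medge F) :=
  [rel e e' | (side_from e' == side_to e) || (side_from e' == glue L (side_to e))].

Definition mpath (P : seq (medge F)) : bool := sorted consecutive P.

Definition closed_mpath (P : seq (medge F)) : bool := cycle consecutive P.

(* The counterclockwise boundaries of the faces F_Q and F_v.  In the second
   case s lists the corners at v in counterclockwise order, and [Q, v] is
   oriented oppositely to the boundary of F_Q. *)
Inductive face_boundary : seq (medge F) -> Prop :=
| boundary_FQ (Q : F) :
    face_boundary [seq ((Q, c), true) | c <- [:: Bm; Wm; Bp; Wp]]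
| boundary_Fv (s : seq (F * corner)) :
    s != [::] -> ufcycle (rotation (glue L)) s ->
    face_boundary [seq (x, false) | x <- s].

(** * Simple connectedness *)

Inductive elementary_homotopy : seq (medge F) -> seq (medge F) -> Prop :=
| homotopy_spur (P P' : seq (medge F)) (e : medge F) :
    mpath (P ++ [:: e; reverse e] ++ P') ->
    elementary_homotopy (P ++ P') (P ++ [:: e; reverse e] ++ P')
| homotopy_face (P P' B : seq (medge F)) :
    face_boundary B -> mpath (P ++ B ++ P') ->
    elementary_homotopy (P ++ P') (P ++ B ++ P').

Definition homotopic : seq (medge F) -> seq (medge F) -> Prop :=
  clos_refl_sym_trans _ elementary_homotopy.

Definition simply_connected : Prop :=
  forall P, closed_mpath P -> homotopic P [::].

(** * Discrete differentials *)

Variable R : realType.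
Implicit Type omega : medge F -> R[i].

Definition one_form omega : Prop :=
  forall e, omega (reverse e) = - omega e.

Definition integral omega (P : seq (medge F)) : R[i] := \sum_(e <- P) omega e.

Definition type_diamond omega : Prop :=
  forall Q c, omega ((Q, c), true) = - omega ((Q, opp c), true).

Definition closed_form omega : Prop :=
  forall B, face_boundary B -> integral omega B = 0.

Definition holomorphic_differential (z : F -> corner -> R[i]) omega : Prop :=
  [/\ one_form omega, type_diamond omega, closed_form omega
    & forall Q, exists p : R[i], forall c o,
        omega ((Q, c), o) = p * dz z ((Q, c), o)].

End Medial.

(** * Homology, canonical bases and periods (compact case) *)

Section Homology.
Variables (F V : finType) (L : quad_decomposition F V).

(* integral 1-chains of X; the coefficient at (Q, c) is that of the oriented
   edge ((Q, c), true) *)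
Definition chain := {ffun F * corner -> int}.

Definition chain_of (P : seq (medge F)) : chain :=
  [ffun x => (count_mem ((x, true) : medge F) P)%:Z
           - (count_mem ((x, false) : medge F) P)%:Z].

(* the midpoint of the side (Q, c) is the end of ((Q, c), true) and the start
   of ((Q, next c), true); two more edges of X meet there in the face glued to Q
   along this side *)
Definition is_cycle (u : chain) : Prop :=
  let outflow (x : F * corner) := u (x.1, next x.2) - u x in
  forall x, outflow x + outflow (glue L x) = 0.

Definition boundary_F (Q : F) : chain := [ffun x => (x.1 == Q)%:Z].

Definition boundary_V (v : V) : chain := [ffun x => - (vtx L x == v)%:Z].

Definition homologous (u u' : chain) : Prop :=
  exists (n : F -> int) (m : V -> int),
    u - u' = \sum_Q boundary_F Q *~ n Q + \sum_v boundary_V v *~ m v.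

(* coefficient in u of the oriented diagonal d of Q, each edge of X being
   replaced by the diagonal to which it is parallel *)
Definition along (u : chain) (d : diagonal F) : int :=
  u (d.1, prev d.2) - u (d.1, next d.2).

(* Following only the black (resp. white) endpoints of the edges of Lambda whose
   midpoints are visited, a cycle on X is homologous to a cycle on Gamma
   (resp. Gamma^* ).  The intersection number is that of the Gamma-cycle of u
   and the Gamma^*-cycle of u', which cross only at the centers of faces, where
   b- b+ crosses w- w+ with sign +1. *)
Definition intersection (u u' : chain) : int :=
  \sum_(Q : F) along u (Q, Bp) * along u' (Q, Wp).

(* homology classes are given by cycles representing them *)
Definition canonical_basis (g : nat) (a b : 'I_g -> chain) : Prop :=
  [/\ forall j, is_cycle (a j) /\ is_cycle (b j),
      forall u, is_cycle u -> exists n m : 'I_g -> int,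
        homologous u (\sum_j (a j *~ n j + b j *~ m j)),
      forall n m : 'I_g -> int,
        homologous (\sum_j (a j *~ n j + b j *~ m j)) 0 ->
        forall j, n j = 0 /\ m j = 0
    & forall j k,
        [/\ intersection (a j) (a k) = 0, intersection (b j) (b k) = 0
          & intersection (a j) (b k) = (j == k)%:Z]].

Variable R : realType.

(* the black (col = true) or white (col = false) period of omega along the class
   of u equals w *)
Definition has_period (col : bool) (omega : medge F -> R[i]) (u : chain)
    (w : R[i]) : Prop :=
  forall P, closed_mpath L P -> homologous (chain_of P) u ->
    2 * integral omega [seq e <- P | black_edge e == col] = w.

Definition canonical_set (z : F -> corner -> R[i]) (g : nat)
    (a : 'I_g -> chain) (omega : 'I_g -> medge F -> R[i]) : Prop :=
  (forall k, holomorphic_differential L z (omega k)) /\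
  (forall j k col, has_period col (omega k) (a j) (j == k)%:R).

End Homology.

(** * Universal covering and discrete Abel-Jacobi map *)

(* A covering is given on faces; corner labels upstairs are the lifted ones.
   The last condition says that it is unbranched: going around a vertex closes
   up upstairs whenever it does downstairs. *)
Definition covering (F V F' V' : eqType) (L : quad_decomposition F V)
    (L' : quad_decomposition F' V') (p : F' -> F) : Prop :=
  let pc (x : F' * corner) := (p x.1, x.2) in
  [/\ forall Q, exists Q', p Q' = Q,
      forall x, pc (glue L' x) = glue L (pc x)
    & forall x n, iter n (rotation (glue L)) (pc x) = pc x ->
        iter n (rotation (glue L')) x = x].

Definition universal_covering (F V F' V' : eqType) (L : quad_decomposition F V)
    (L' : quad_decomposition F' V') (p : F' -> F) : Prop :=
  covering L L' p /\ simply_connected L'.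

Definition lift_chart (R : realType) (F F' : eqType) (p : F' -> F)
    (z : F -> corner -> R[i]) : F' -> corner -> R[i] := fun Q c => z (p Q) c.

Definition lift_form (R : realType) (F F' : eqType) (p : F' -> F)
    (omega : medge F -> R[i]) : medge F' -> R[i] :=
  fun e => omega ((p e.1.1, e.1.2), e.2).

Section AbelJacobi.
Variables (F V : eqType) (L : quad_decomposition F V).
Variables (R : realType) (g : nat) (omega : 'I_g -> medge F -> R[i]).

(* a path of oriented diagonals from v to w; it stays on Gamma or on Gamma^*
   since both ends of a diagonal have the same colour *)
Fixpoint diagonal_path (v : V) (P : seq (diagonal F)) (w : V) : Prop :=
  if P is d :: P' then
    vtx L (d.1, opp d.2) = v /\ diagonal_path (vtx L d) P' w
  else v = w.

Definition integral_vector (P : seq (medge F)) : 'cV[R[i]]_g :=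
  \col_k integral (omega k) P.

(* the values at v produced by all choices of the vertex vtx (Q, c) of Q, of the
   edge d, of the path P and of the parallel chain PX *)
Definition abel_jacobi_values (Q : F) (v : V) : set 'cV[R[i]]_g :=
  [set y | exists (c : corner) (d : medge F) (P : seq (diagonal F))
             (PX : seq (medge F)),
     [/\ is_black c = black L v,
         parallel d = (Q, c),
         diagonal_path (vtx L (Q, c)) P v,
         [seq parallel e | e <- PX] = P
       & y = integral_vector [:: d] + 2 *: integral_vector PX]]%classic.

(* xget chooses an element of the set (and would be 0 on the empty set) *)
Definition abel_jacobi (Q : F) (v : V) : 'cV[R[i]]_g :=
  xget 0 (abel_jacobi_values Q v).

End AbelJacobi.

(* Main.v *)
(** The black and the white parts of a closed differential of type diamond are
    both closed: the two edges of one colour on the boundary of a face [F_Q]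
    cancel, and all edges of the boundary of a face [F_v] have the same colour.
    On a simply connected surface each part has a primitive on the midpoints of
    the sides.  The black part vanishes on the edges of [X] around a black
    vertex, so its primitive is constant on the sides at that vertex and, up to
    a factor 2, descends to a function on the black vertices whose increments
    along the diagonals are the integrals of the form; similarly for white.
    The discrete Abel-Jacobi map agrees with this function up to one constant
    per colour, and the condition of holomorphicity only compares vertices of
    the same colour. *)
From Pilot Require Import Defs.
From mathcomp Require Import all_boot all_order all_algebra.
From mathcomp Require Import complex.
From mathcomp Require Import boolp classical_sets reals.
From mathcomp Require Import ring.
(* [path.v] also defines [next] and [prev] *)
Import Pilot.Defs.
Set Implicit Arguments.
Unset Strict Implicit.
Unset Printing Implicit Defensive.
Import Order.TTheory GRing.Theory Num.Theory.
Local Open Scope ring_scope.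
Local Open Scope complex_scope.

Local Arguments side_from : simpl never.
Local Arguments side_to : simpl never.
Local Arguments reverse : simpl never.

(** * Corners and charts *)

Lemma prevK : cancel prev next. Proof. by case. Qed.
Lemma nextK : cancel next prev. Proof. by case. Qed.
Lemma oppK : involutive opp. Proof. by case. Qed.
Lemma prev_prev c : prev (prev c) = opp c. Proof. by case: c. Qed.
Lemma is_black_next c : is_black (next c) = ~~ is_black c.
Proof. by case: c. Qed.
Lemma is_black_prev c : is_black (prev c) = ~~ is_black c.
Proof. by case: c. Qed.
Lemma is_black_opp c : is_black (opp c) = is_black c.
Proof. by case: c. Qed.

(** If opposite corners had the same image, that point would start two opposite sides, which are
    disjoint in a chart. This makes division by the diagonals of a chart legitimate. *)
Lemma chart_opp_neq (R : realType) (zQ : corner -> R[i]) (c : corner) :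
  is_chart zQ -> zQ c <> zQ (opp c).
Proof.
move=> [disj _ _] eqz.
have start (x y : R[i]) : segment x y x.
  exists 0; split; first by rewrite lexx ler01.
  by rewrite subr0 mul1r mul0r addr0.
have oppE : next (next c) = opp c by case: c {eqz}.
have : (segment (zQ c) (zQ (next c)) `&`
        segment (zQ (next (next c))) (zQ (prev c)))%classic (zQ c).
  by split; [exact: start | rewrite oppE -eqz; exact: start].
by rewrite disj.
Qed.

(** * Paths on the medial graph *)

Section QuadDecompositionTheory.
Variables (F V : eqType) (L : quad_decomposition F V).
Implicit Types (e : medge F) (x : F * corner).

Lemma reverseK : involutive (@reverse F).
Proof. by case=> x o; rewrite /reverse /= negbK. Qed.

Lemma side_from_reverse e : side_from (reverse e) = side_to e.
Proof. by case: e => x []. Qed.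

Lemma side_to_reverse e : side_to (reverse e) = side_from e.
Proof. by case: e => x []. Qed.

Lemma vtx_rotation x : vtx L (rotation (glue L) x) = vtx L x.
Proof. by apply/esym/vtx_eq; exists 1%N. Qed.

Lemma vtx_glue x : vtx L (glue L x) = vtx L (x.1, next x.2).
Proof.
rewrite -(vtx_rotation (x.1, next x.2)) /rotation /= nextK.
by rewrite -surjective_pairing.
Qed.

Lemma is_black_rotation x : is_black (rotation (glue L) x).2 = is_black x.2.
Proof. by rewrite -!(black_vtx L) vtx_rotation. Qed.

Lemma consecutiveE e e' : consecutive L e e' =
  (side_from e' == side_to e) || (side_from e' == glue L (side_to e)).
Proof. by []. Qed.

Lemma consecutive_reverse e e' :
  consecutive L (reverse e') (reverse e) = consecutive L e e'.
Proof.
rewrite !consecutiveE !side_from_reverse side_to_reverse eq_sym; congr (_ || _).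
by rewrite -(inj_eq (can_inj (glueK L))) glueK eq_sym.
Qed.

Lemma consecutive_backtrack e : consecutive L e (reverse e).
Proof. by rewrite consecutiveE side_from_reverse eqxx. Qed.

Lemma path_reverse e s :
  path (consecutive L) e s ->
  path (consecutive L) (reverse (last e s))
    (behead [seq reverse e' | e' <- rev (e :: s)]).
Proof.
elim/last_ind: s e => [//|s e' IHs] e.
rewrite rcons_path last_rcons => /andP[es see'].
rewrite -rcons_cons rev_rcons /=.
have := IHs _ es.
case E: [seq reverse e0 | e0 <- rev (e :: s)] => [|e1 s1] /=.
  by have := congr1 size E; rewrite size_map size_rev.
have -> : e1 = reverse (last e s).
  move: E; rewrite lastI rev_rcons /=; by case.
by move=> ->; rewrite andbT consecutive_reverse.
Qed.

(** At both turning points the path backtracks, which [consecutive] allows. Two paths with the same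
    ends are compared by applying simple connectedness to this closed path. *)
Lemma cycle_there_and_back e0 s s' :
  path (consecutive L) e0 s -> path (consecutive L) e0 s' ->
  last e0 s = last e0 s' ->
  closed_mpath L ((e0 :: s) ++ [seq reverse e | e <- rev (e0 :: s')]).
Proof.
move=> es es' ess'.
rewrite /closed_mpath cat_cons /cycle rcons_cat cat_path es /=.
have back := path_reverse es'.
have := consecutive_backtrack (last e0 s').
move: back; rewrite ess'.
rewrite lastI rev_rcons [map _ _]/= [behead _]/=.
set t := [seq _ | e <- rev (belast e0 s')] => back cons.
rewrite rcons_path /= back cons /=.
suff -> : last (reverse (last e0 s')) t = reverse e0.
  by have := consecutive_backtrack (reverse e0); rewrite reverseK.
have : last e0 (reverse (last e0 s') :: t) =
       last e0 [seq reverse e | e <- rev (e0 :: s')].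
  by rewrite [e0 :: s']lastI rev_rcons.
by rewrite /= => ->; rewrite rev_cons map_rcons last_rcons.
Qed.

Definition mreach e e' :=
  exists2 s, path (consecutive L) e s & last e s = e'.

Lemma mreach_refl e : mreach e e. Proof. by exists [::]. Qed.

Lemma mreach1 e e' : consecutive L e e' -> mreach e e'.
Proof. by move=> ee'; exists [:: e'] => //=; rewrite andbT. Qed.

Lemma mreach_trans e2 e1 e3 : mreach e1 e2 -> mreach e2 e3 -> mreach e1 e3.
Proof.
move=> [s ps <-] [s' ps' <-]; exists (s ++ s'); last by rewrite last_cat.
by rewrite cat_path ps.
Qed.

Lemma mreach_next P c : mreach ((P, c), true) ((P, next c), true).
Proof.
by apply: mreach1; rewrite consecutiveE /side_from /side_to /= nextK eqxx.
Qed.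

Lemma mreach_face P c c' : mreach ((P, c), true) ((P, c'), true).
Proof.
have := mreach_next P; case: c c' => -[] H; try exact: mreach_refl;
  try (exact: (H Bm)); try (exact: (H Wm)); try (exact: (H Bp));
  try (exact: (H Wp)).
- exact: mreach_trans (H Bm) (H Wm).
- exact: mreach_trans (H Bm) (mreach_trans (H Wm) (H Bp)).
- exact: mreach_trans (H Wm) (mreach_trans (H Bp) (H Wp)).
- exact: mreach_trans (H Wm) (H Bp).
- exact: mreach_trans (H Bp) (H Wp).
- exact: mreach_trans (H Bp) (mreach_trans (H Wp) (H Bm)).
- exact: mreach_trans (H Wp) (H Bm).
- exact: mreach_trans (H Wp) (mreach_trans (H Bm) (H Wm)).
Qed.

(** The path enters the glued face through the common midpoint and turns back at once, returning to
    that midpoint, now taken as lying on a side of the glued face. *)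
Lemma mreach_glue x : mreach (x, true) (glue L x, true).
Proof.
apply: (@mreach_trans (glue L x, false)).
  by apply: mreach1; rewrite consecutiveE /side_from /side_to /= eqxx orbT.
exact: mreach1 (consecutive_backtrack (glue L x, false)).
Qed.

Lemma mreach_total P c e : mreach ((P, c), true) e.
Proof.
have reach_true x : mreach ((P, c), true) (x, true).
  case: x => P' c'; have [s [ps <-]] := connected_faces L P P'.
  elim: s P c ps => [|P1 s IHs] P c /=; first by move=> _; exact: mreach_face.
  case/andP=> /existsP[d /eqP gd] ps.
  apply: mreach_trans (mreach_face P c d) _.
  apply: mreach_trans (mreach_glue _) _.
  by rewrite [glue L (P, d)]surjective_pairing gd; exact: IHs.
case: e => x [] //.
apply: mreach_trans (reach_true x) _.
exact: mreach1 (consecutive_backtrack (x, true)).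
Qed.

(** * Connectedness of the black and of the white graph *)

Definition dreach v w := exists P, diagonal_path L v P w.

Lemma dreach_trans w v u : dreach v w -> dreach w u -> dreach v u.
Proof.
move=> [P + [P' P'wu]]; elim: P v => [v ->|d P IHP v [<- /IHP[P1 H1]]] /=.
  by exists P'.
by exists (d :: P1).
Qed.

Lemma dreach_face P c c' : is_black c = is_black c' ->
  dreach (vtx L (P, c)) (vtx L (P, c')).
Proof.
move=> cc'; have [->|->] : c' = c \/ c' = opp c.
    by case: c c' cc' => -[] // _; [left|right|left|right|right|left|right|left].
  by exists [::].
by exists [:: (P, opp c)]; rewrite /= oppK.
Qed.

(** A common edge has one endpoint of each colour, so adjacent faces share a vertex of either
    colour. *)
Lemma adjacent_face_corner P d (col : bool) : exists c1 c2,
  [/\ is_black c1 = col, is_black c2 = col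
    & vtx L (P, c1) = vtx L ((glue L (P, d)).1, c2)].
Proof.
set y := glue L (P, d).
have E1 : vtx L (P, next d) = vtx L (y.1, y.2).
  by rewrite -surjective_pairing vtx_glue.
have E2 : vtx L (P, d) = vtx L (y.1, next y.2).
  by rewrite -vtx_glue glueK.
have [dcol|dcol] := eqVneq (is_black d) col.
  exists d, (next y.2); split=> //.
  by rewrite -dcol -[LHS](black_vtx L (y.1, next y.2)) -E2 black_vtx.
exists (next d), y.2; have ndcol : is_black (next d) = col.
  by rewrite is_black_next; case: (is_black d) col dcol => -[].
split=> //.
by rewrite -ndcol -[LHS](black_vtx L (y.1, y.2)) -E1 black_vtx.
Qed.

(** In a chain of adjacent faces, at most one diagonal per face leads to the vertex of the given
    colour shared with the next face. *)
Lemma dreach_total P c v : is_black c = black L v -> dreach (vtx L (P, c)) v.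
Proof.
have [[P' c'] <-] := vtx_surj L v; rewrite black_vtx /=.
have [s [ps <-]] := connected_faces L P P'.
elim: s P c ps => [|P1 s IHs] P c /=; first by move=> _; exact: dreach_face.
case/andP=> /existsP[d /eqP gd] ps cc'.
have [c1 [c2 [c1c c2c E]]] := adjacent_face_corner P d (is_black c).
apply: dreach_trans (dreach_face P (esym c1c)) _.
by rewrite E gd; apply: IHs => //; rewrite c2c.
Qed.

(** * Integration and primitives *)

Variable R : realType.
Implicit Type theta : medge F -> R[i].

Lemma integral_cat theta s s' :
  integral theta (s ++ s') = integral theta s + integral theta s'.
Proof. exact: big_cat. Qed.

Lemma integral_reverse theta s : one_form theta ->
  integral theta [seq reverse e | e <- rev s] = - integral theta s.
Proof.
move=> th; rewrite /integral big_map -sumrN (eq_bigr _ (fun e _ => th e)).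
by apply: perm_big; rewrite perm_rev.
Qed.

Lemma integral_homotopic theta P P' :
  one_form theta -> closed_form L theta -> homotopic L P P' ->
  integral theta P = integral theta P'.
Proof.
move=> th cl.
elim=> {P P'} // [P P' [{}P {}P' e|{}P {}P' B] hB|P P' P'' _ -> _ ->//].
- by rewrite !integral_cat /integral big_cons big_seq1 th subrr add0r.
- by move=> _; rewrite !integral_cat (cl _ hB) add0r.
Qed.

(** Integrate from a base edge to the midpoint of the side; simple connectedness makes the result
    independent of the path. Invariance under [glue] holds because glued sides have the same
    midpoint. *)
Lemma primitive_on_sides theta (P0 : F) :
  simply_connected L -> one_form theta -> closed_form L theta ->
  exists h : F * corner -> R[i], (forall x, h (glue L x) = h x) /\
    forall P c, h (P, c) = h (P, prev c) + theta ((P, c), true).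
Proof.
move=> sc th cl.
pose e0 : medge F := ((P0, Bm), true).
have uniqH s s' : path (consecutive L) e0 s -> path (consecutive L) e0 s' ->
    last e0 s = last e0 s' -> integral theta s = integral theta s'.
  move=> ps ps' ll; have := sc _ (cycle_there_and_back ps ps' ll).
  move/(integral_homotopic th cl); rewrite integral_cat integral_reverse //.
  (* Both halves of the closed path contain [e0], whose contributions cancel. *)
  rewrite /integral !big_cons big_nil.
  by move/eqP; rewrite subr_eq0 => /eqP/addrI.
have /choice[H HP] : forall e, exists w, forall s, path (consecutive L) e0 s ->
    last e0 s = e -> integral theta s = w.
  move=> e; have [s ps se] := mreach_total P0 Bm e.
  by exists (integral theta s) => s' ps' s'e; apply: uniqH => //; rewrite s'e.
have step e e' : consecutive L e e' -> H e' = H e + theta e'.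
  move=> ee'; have [s ps se] := mreach_total P0 Bm e.
  rewrite -(HP e s) // -(HP e' (rcons s e')).
  - by rewrite -cats1 integral_cat /integral big_seq1.
  - by rewrite rcons_path ps -/e0 se.
  - by rewrite last_rcons.
(* [(x, true)] ends at the midpoint of the side [x]. Passing to [glue L x] adds an edge and its
   reverse. *)
exists (fun x => H (x, true)); split=> [x|P c].
  have e1 : consecutive L (x, true) (reverse (glue L x, true)).
    by rewrite consecutiveE /side_from /side_to /= eqxx orbT.
  have e2 := consecutive_backtrack (reverse (glue L x, true)).
  by rewrite reverseK in e2; rewrite (step _ _ e2) (step _ _ e1) th subrK.
by apply: step; rewrite consecutiveE /side_from /side_to /= eqxx.
Qed.

(** * Black and white parts, and potentials on the vertices *)

Definition colour_part (col : bool) theta : medge F -> R[i] :=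
  fun e => if black_edge e == col then theta e else 0.

Lemma colour_part_one_form col theta :
  one_form theta -> one_form (colour_part col theta).
Proof.
move=> th [[P c] o]; rewrite /colour_part th.
have -> : black_edge (reverse ((P, c), o)) = black_edge ((P, c), o).
  by rewrite /black_edge; case: c o => -[].
by case: ifP => //; rewrite oppr0.
Qed.

(** The edge [[Q, v]] cuts off the corner at [v], so it is parallel to the diagonal joining the two
    neighbours of [v] in [Q]. *)
Lemma black_edge_around x :
  black_edge ((x, false) : medge F) = ~~ black L (vtx L x).
Proof. by rewrite /black_edge /= is_black_prev black_vtx. Qed.

(** Listed from [x] on, the cycle is a segment of the forward orbit of [x]. Hence all corners on the
    boundary of one [F_v] lie at the same vertex. *)
Lemma ufcycle_black s x y : ufcycle (rotation (glue L)) s ->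
  x \in s -> y \in s -> exists n, iter n (rotation (glue L)) x = y.
Proof.
case/andP=> cs us xs; have [i s' rs] := rot_to xs.
rewrite -(mem_rot i) rs => ys.
have : fcycle (rotation (glue L)) (x :: s') by rewrite -rs rot_cycle.
rewrite /cycle rcons_path => /andP[/fpathP[n def_s'] _].
have : y \in traject (rotation (glue L)) x n.+1 by rewrite trajectS -def_s'.
by case/trajectP=> j _ ->; exists j.
Qed.

Lemma colour_part_closed col theta :
  type_diamond theta -> closed_form L theta ->
  closed_form L (colour_part col theta).
Proof.
move=> td cl B [P|s s0 us].
  rewrite /integral /= !big_cons big_nil /colour_part /black_edge /=.
  have E1 := td P Bm; have E2 := td P Wm; rewrite /= in E1 E2.
  by case: col; rewrite /= ?E1 ?E2; ring.
case: s s0 us => // x s _ us.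
have sameb y : y \in x :: s ->
    black_edge ((y, false) : medge F) = black_edge ((x, false) : medge F).
  move=> ys; have [n xy] := ufcycle_black us (mem_head x s) ys.
  rewrite !black_edge_around; congr (~~ black L _).
  by apply/esym/vtx_eq; exists n.
have := cl _ (boundary_Fv (isT : x :: s != [::]) us).
rewrite /integral !big_map => int0.
have [bx|bx] := eqVneq (black_edge ((x, false) : medge F)) col.
  rewrite -[RHS]int0 !big_seq; apply: eq_bigr => y ys.
  by rewrite /colour_part sameb // bx eqxx.
rewrite big_seq big1 // => y ys.
by rewrite /colour_part sameb // (negbTE bx).
Qed.

(** The edge on the right is parallel to the diagonal from [opp c] to [c]; the factor 2 reflects
    that an edge of [X] is half as long as its diagonal. *)
Lemma potential_on_vertices theta (P0 : F) :
  simply_connected L -> one_form theta -> type_diamond theta ->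
  closed_form L theta ->
  exists f : V -> R[i], forall P c,
    f (vtx L (P, c)) - f (vtx L (P, opp c)) = 2 * theta ((P, prev c), true).
Proof.
move=> sc th td cl.
have prim col := primitive_on_sides P0 sc (colour_part_one_form col th)
  (@colour_part_closed col theta td cl).
have /choice[h hP] := prim.
(* Going from one side at a vertex to the next follows an edge of [X] of the other colour, where
   this part vanishes. *)
have wd x y : vtx L x = vtx L y -> h (is_black x.2) x = h (is_black y.2) y.
  move/vtx_eq=> [n <-]; elim: n => //= n ->.
  set w := iter n _ x; rewrite is_black_rotation /rotation.
  have [-> hw] := hP (is_black w.2).
  rewrite [w in LHS]surjective_pairing [LHS]hw /colour_part /black_edge /=.
  by rewrite is_black_next; case: (is_black w.2); rewrite addr0.
have /choice[side sideP] := vtx_surj L.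
exists (fun v => 2 * h (is_black (side v).2) (side v)) => P c.
rewrite (wd _ _ (sideP (vtx L (P, c)))) (wd _ _ (sideP (vtx L (P, opp c)))) /=.
rewrite is_black_opp -mulrBr; congr (2 * _).
have [_ hc] := hP (is_black c).
(* Two edges lead from the side [opp c] to the side [c]; only the one at [prev c] has the colour of
   [c]. *)
rewrite hc hc prev_prev /colour_part /black_edge /= prevK is_black_next eqxx.
by case: (is_black c); ring.
Qed.

(** * From potentials to the Abel-Jacobi map *)

Lemma parallel_form theta e : one_form theta -> type_diamond theta ->
  theta e = theta ((((parallel e).1, prev (parallel e).2), true)).
Proof.
move=> th td; case: e => [[P c] []]; rewrite /parallel /= ?nextK //.
(* Reversing the edge and passing to the opposite corner each change the sign, so the two edges
   parallel to one oriented diagonal carry the same value. *)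
rewrite prev_prev; have := th ((P, c), true); rewrite /reverse /= => ->.
by rewrite td opprK.
Qed.

(** The increments of [f] telescope, whichever parallel edge represents each diagonal. *)
Lemma diagonal_path_integral theta (f : V -> R[i]) PX v w :
  one_form theta -> type_diamond theta ->
  (forall P c, f (vtx L (P, c)) - f (vtx L (P, opp c)) =
    2 * theta ((P, prev c), true)) ->
  diagonal_path L v [seq parallel e | e <- PX] w ->
  2 * integral theta PX = f w - f v.
Proof.
move=> th td fP; rewrite /integral; elim: PX v => [v ->|e PX IH v] /=.
  by rewrite big_nil mulr0 subrr.
move=> [<- /IH pPX]; rewrite big_cons mulrDr pPX (parallel_form e th td) -fP.
by rewrite -surjective_pairing addrC subrKA.
Qed.

Lemma abel_jacobi_potential (g : nat) (omega : 'I_g -> medge F -> R[i]) (Q : F)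
    (k : 'I_g) (f : V -> R[i]) :
  one_form (omega k) -> type_diamond (omega k) ->
  (forall P c, f (vtx L (P, c)) - f (vtx L (P, opp c)) =
    2 * omega k ((P, prev c), true)) ->
  exists C : bool -> R[i],
    forall v, abel_jacobi L omega Q v k 0 = f v + C (black L v).
Proof.
move=> th td fP.
pose C0 c := omega k ((Q, prev c), true) - f (vtx L (Q, c)).
(* Exchanging the two ends of the diagonal changes the sign of the integral over [d] and shifts [f]
   by twice that integral, so one constant serves both. *)
have C0_opp c : C0 (opp c) = C0 c.
  rewrite /C0; have := fP Q c; have := td Q (prev c).
  have -> : opp (prev c) = prev (opp c) by case: c.
  move=> E1 E2; rewrite -[f (vtx L (Q, c))](subrK (f (vtx L (Q, opp c)))).
  by rewrite E2 E1; ring.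
exists (fun col => C0 (if col then Bp else Wp)) => v.
(* Nonemptiness rules out the default value 0 of [xget]. *)
have ex : (abel_jacobi_values L omega Q v !=set0)%classic.
  pose c := if black L v then Bp else Wp.
  have cv : is_black c = black L v by rewrite /c; case: (black L v).
  have [P QP] := dreach_total Q cv.
  pose PX : seq (medge F) := [seq ((d.1, prev d.2), true) | d <- P].
  eexists; exists c, ((Q, prev c), true), P, PX; split=> //.
    by rewrite /parallel /= prevK.
  rewrite -map_comp -[RHS]map_id; apply: eq_map => -[P' c'].
  by rewrite /parallel /= prevK.
case: ex => y0 y0P.
have [c [d [P [PX [cv dQ pP PXP aj]]]]] : abel_jacobi_values L omega Q v
  (abel_jacobi L omega Q v) by exact: xgetI y0P.
subst P; rewrite aj !mxE (diagonal_path_integral th td fP pP).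
rewrite /integral big_seq1 (parallel_form d th td) dQ /=.
have -> : C0 (if black L v then Bp else Wp) = C0 c.
  by rewrite -cv; case: c {cv dQ pP aj} => //; rewrite -C0_opp.
by rewrite /C0; ring.
Qed.

End QuadDecompositionTheory.

(** * Lifting differentials to the covering *)

Section Lift.
Variables (F V F' V' : eqType) (L : quad_decomposition F V).
Variables (L' : quad_decomposition F' V') (p : F' -> F).
Variables (R : realType) (omega : medge F -> R[i]).

Lemma lift_one_form : one_form omega -> one_form (lift_form p omega).
Proof. by move=> th [[Q c] o]; rewrite /lift_form -th. Qed.

Lemma lift_type_diamond : type_diamond omega -> type_diamond (lift_form p omega).
Proof. by move=> td Q c; rewrite /lift_form -td. Qed.

Lemma lift_closed_form : covering L L' p ->
  closed_form L omega -> closed_form L' (lift_form p omega).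
Proof.
move=> [_ pglue pcyc] cl B [Q|s s0 us].
  by have := cl _ (boundary_FQ L (p Q)); rewrite /integral !big_map.
pose pc (x : F' * corner) := (p x.1, x.2).
have pcrot x : pc (rotation (glue L') x) = rotation (glue L) (pc x).
  exact: pglue.
have pciter n x : pc (iter n (rotation (glue L')) x) =
    iter n (rotation (glue L)) (pc x).
  by elim: n => //= n <-.
(* If a corner and its [n]-th rotate have the same image, the rotation closes up downstairs after
   [n] steps, hence also upstairs since the covering is unbranched. So the boundary of [F_v]
   projects without repetition. *)
have inj_pc : {in s &, injective pc}.
  move=> x y xs ys pxy; have [n xy] := ufcycle_black us xs ys.
  by rewrite -xy; apply/esym/pcyc; rewrite -pciter xy.
have := cl _ (@boundary_Fv _ _ L [seq pc x | x <- s] _ _).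
rewrite /integral !big_map; apply; first by case: s s0 {us inj_pc}.
case/andP: us => cs us; apply/andP; split; last by rewrite map_inj_in_uniq.
rewrite cycle_map; apply: sub_cycle cs => x y /= /eqP <-.
by rewrite pcrot.
Qed.

End Lift.

(** * Holomorphicity of the Abel-Jacobi map *)

Theorem proposition7p11 (R : realType)
  (F V : finType) (L : quad_decomposition F V)
  (z : F -> corner -> R[i]) (Hz : atlas z)
  (g : nat) (Hg : genus L g)
  (a b : 'I_g -> chain F) (Hab : canonical_basis L a b)
  (omega : 'I_g -> medge F -> R[i]) (Homega : canonical_set L z a omega)
  (F' V' : eqType) (L' : quad_decomposition F' V')
  (p : F' -> F) (Hp : universal_covering L L' p)
  (Q : F') :
  forall k : 'I_g,
    discrete_holomorphic L' (lift_chart p z)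
      (fun v => abel_jacobi L' (fun j => lift_form p (omega j)) Q v k 0).
Proof.
move=> k; case: Homega => /(_ k)[th td cl hol] _; case: Hp => cov sc.
have th' := lift_one_form p th.
have td' := lift_type_diamond p td.
have [f fP] := potential_on_vertices Q sc th' td' (lift_closed_form cov cl).
have [C CP] := abel_jacobi_potential
  (omega := fun j => lift_form p (omega j)) Q th' td' fP.
move=> P; have [q qP] := hol (p P).
(* Along either diagonal, [f] grows by twice [q] times half the diagonal of the chart. *)
have slope c : (f (vtx L' (P, c)) - f (vtx L' (P, opp c))) /
    (lift_chart p z P c - lift_chart p z P (opp c)) = q.
  rewrite fP /lift_form /= qP /dz /parallel /= prevK /lift_chart.
  set D := z _ _ - _; have D0 : D != 0.
    by rewrite subr_eq0; apply/eqP; exact: chart_opp_neq.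
  by rewrite mulrCA [2 * _]mulrC divfK ?pnatr_eq0 // mulfK.
(* The two ends of a diagonal have the same colour, so the constants [C] cancel. *)
by rewrite !CP !black_vtx /= !opprD !(addrACA _ (C _)) !subrr !addr0
   (slope Bp) (slope Wp).
Qed.
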